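(* Let $G$ be a unipotent algebraic $\mathbb{Z}$-group. Then $$\zeta_G(s) = \prod_{p} \zeta_{G,p}(s)$$ as a formal product of Dirichlet series over all primes $p$, where $\zeta_G$ and $\zeta_{G,p}$ are the global and local commensurability zeta functions of $G$.
   Context: A unipotent algebraic $\mathbb{Z}$-group is a unipotent algebraic group $G$ defined over $\mathbb{Z}$. It is regarded as embedded as a closed subgroup of a group of lower-triangular unipotent matrices (Kolchin's theorem), and $G(R)$ denotes its group of $R$-points. For subgroups $\Delta_1,\Delta_2$ of a common group, the commensurability index is $\mathrm{c}(\Delta_1,\Delta_2) := [\Delta_1:\Delta_1\cap\Delta_2]\,[\Delta_2:\Delta_1\cap\Delta_2]$; the two subgroups are commensurable if this is finite. An arithmetic lattice in $G$ is a subgroup of $G(\mathbb{R})$ commensurable with $G(\mathbb{Z})$. Let $\mathcal{L}(G)$ be the set of all arithmetic lattices in $G$, and for a prime $p$ let $\mathcal{L}_{(p)}(G)$ be the set of $\Delta\in\mathcal{L}(G)$ such that $\mathrm{c}(\Delta,G(\mathbb{Z}))$ is a power of $p$ (including $p^0=1$). For a family $\mathcal{F}$ of subgroups of $G(\mathbb{R})$ put $\mathbf{c}_n(\mathcal{F}) := |\{\Delta\in\mathcal{F} : \mathrm{c}(G(\mathbb{Z}),\Delta)=n\}|$ and $\zeta_{\mathcal{F}}(s) := \sum_{n=1}^\infty \mathbf{c}_n(\mathcal{F})\,n^{-s}$. Then $\zeta_G := \zeta_{\mathcal{L}(G)}$ and $\zeta_{G,p} := \zeta_{\mathcal{L}_{(p)}(G)}$.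 *)

(* Defs.v *)
From HB Require Import structures.
From mathcomp Require Import all_boot all_order all_algebra.
From mathcomp Require Import finmap mpoly.
From mathcomp Require Import boolp classical_sets functions cardinality reals.

Set Implicit Arguments.
Unset Strict Implicit.
Unset Printing Implicit Defensive.

Import GRing.Theory.
Local Open Scope classical_set_scope.
Local Open Scope ring_scope.

(* Subgroups are subsets of 'M[A]_d that are groups for *m with unit 1%:M. The
   ring A is only a comNzRingType, so inverses are given by an existential. *)
Definition is_subgroup (A : comNzRingType) (d : nat) (H : set 'M[A]_d) : Prop :=
  [/\ H 1%:M,
      forall X Y, H X -> H Y -> H (X *m Y) &
      forall X, H X -> exists Y, [/\ H Y, X *m Y = 1%:M & Y *m X = 1%:M]].

Definition unitriangular (A : comNzRingType) (d : nat) : set 'M[A]_d :=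
  [set X : 'M[A]_d | forall i j : 'I_d, (i <= j)%N -> X i j = (i == j)%:R].
Arguments unitriangular A d : clear implicits.

(* The variable of index mxvec_index i j stands for the (i, j) entry. *)
Definition eval_mx (A : comNzRingType) (d : nat)
    (X : 'M[A]_d) (f : {mpoly int[d * d]}) : A :=
  mmap (intr : int -> A) (fun k => mxvec X 0 k) f.

Definition zero_locus (d : nat) (S : set {mpoly int[d * d]})
    (A : comNzRingType) : set 'M[A]_d :=
  [set X | unitriangular A d X /\ forall f, S f -> eval_mx X f = 0].
Arguments zero_locus [d] S A _.

(* A closed subgroup scheme over Z of the group scheme of lower-triangular
   unipotent d x d matrices: a closed subscheme, given by integral equations,
   whose A-points form a group for every commutative ring A. The zero ring can
   be left out, since matrices over it have a single point. *)
Record unipotent_Zgroup (d : nat) := UnipotentZgroup {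
  equations : set {mpoly int[d * d]};
  zero_locus_subgroup :
    forall A : comNzRingType, is_subgroup (zero_locus equations A)
}.

Definition points (d : nat) (G : unipotent_Zgroup d) (A : comNzRingType) :
  set 'M[A]_d := zero_locus (equations G) A.
Arguments points [d] G A _.

Definition left_cosets (A : comNzRingType) (d : nat) (H K : set 'M[A]_d) :
  set (set 'M[A]_d) := [set mulmx X @` K | X in H].

(* #|` fset_set _| is the cardinal of a finite set and 0 on an infinite one. *)
Definition subgroup_index (A : comNzRingType) (d : nat) (H K : set 'M[A]_d) : nat :=
  #|` fset_set (left_cosets H K)|.

Definition commensurable (A : comNzRingType) (d : nat)
    (D1 D2 : set 'M[A]_d) : Prop :=
  finite_set (left_cosets D1 (D1 `&` D2)) /\
  finite_set (left_cosets D2 (D1 `&` D2)).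

Definition cindex (A : comNzRingType) (d : nat) (D1 D2 : set 'M[A]_d) : nat :=
  (subgroup_index D1 (D1 `&` D2) * subgroup_index D2 (D1 `&` D2))%N.

Section Zeta.

Variables (R : realType) (d : nat) (G : unipotent_Zgroup d).

(* G(Z), as a subset of G(R) *)
Definition integral_points : set 'M[R]_d :=
  [set map_mx (intr : int -> R) X | X in points G int].

Definition lattices : set (set 'M[R]_d) :=
  [set D | [/\ is_subgroup D, D `<=` points G R &
               commensurable D integral_points]].

Definition plattices (p : nat) : set (set 'M[R]_d) :=
  [set D | lattices D /\ exists k : nat, cindex D integral_points = (p ^ k)%N].

Definition of_cindex (F : set (set 'M[R]_d)) (n : nat) : set (set 'M[R]_d) :=
  [set D | F D /\ cindex integral_points D = n].

(* A formal Dirichlet series is the function n |-> coefficient of n^(-s); only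
   its values at n >= 1 are meaningful. *)
Definition zeta (F : set (set 'M[R]_d)) (n : nat) : nat :=
  #|` fset_set (of_cindex F n)|.

Definition zeta_defined (F : set (set 'M[R]_d)) : Prop :=
  forall n : nat, (0 < n)%N -> finite_set (of_cindex F n).

End Zeta.

Arguments integral_points R [d] G _.
Arguments lattices R [d] G _.
Arguments plattices R [d] G p _.

Definition dirichlet_one (n : nat) : nat := n == 1%N.

Definition dirichlet_mul (a b : nat -> nat) (n : nat) : nat :=
  (\sum_(k <- divisors n) a k * b (n %/ k))%N.

(* f is the formal product of the series z p over all primes p: each coefficient
   of f is that of every large enough finite partial product. *)
Definition is_prime_product (f : nat -> nat) (z : nat -> nat -> nat) : Prop :=
  forall n : nat, (0 < n)%N ->
  exists N : nat, forall s : seq nat,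
    uniq s -> all prime s ->
    (forall p : nat, prime p -> (p <= N)%N -> p \in s) ->
    (\big[dirichlet_mul/dirichlet_one]_(p <- s) z p) n = f n.

(* Main.v *)
(** For each n there is a group L of rational matrices in G(R) with bounded
    denominators which contains all lattices of commensurability index at most n: an element of
    such a lattice has its n!-th power in G(Z), and taking a root of a unipotent
    matrix introduces bounded denominators only. The elements of L in turn have
    a uniform power in G(Z), so that all these lattices contain the subgroup N
    generated by the K-th powers of L for a suitable K, and N has finite index in
    L because L is nilpotent of finite rank. Those lattices thus
    correspond to subgroups of the finite nilpotent group L / N. Each of them is
    the product of its pi-part and its pi'-part, which makes the number of
    lattices of given index multiplicative on coprime integers. *)

Require Import Defs.
From mathcomp Require Import all_boot all_order all_algebra.
From mathcomp Require Import all_fingroup all_solvable.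
From mathcomp Require Import finmap.
From mathcomp Require mpoly.
From mathcomp Require Import boolp classical_sets functions cardinality reals.
From mathcomp Require Import zify ring.
Set Implicit Arguments.
Unset Strict Implicit.
Unset Printing Implicit Defensive.
Import Order.TTheory GRing.Theory Num.Theory.

(** * Euler products of multiplicative coefficients *)

Section EulerProduct.
Variables (f : nat -> nat) (z : nat -> nat -> nat).
Hypothesis f1 : f 1%N = 1%N.
Hypothesis f_coprime : forall m k : nat, (0 < m)%N -> (0 < k)%N ->
  coprime m k -> f (m * k)%N = (f m * f k)%N.
Hypothesis z_pnat : forall p n : nat, prime p -> (0 < n)%N ->
  z p n = if p.-nat n then f n else 0%N.

(** Induction on [s]. In the convolution of [z p] with the product over [s], a divisor [k]
    contributes only if [k] is a power of [p] and [n %/ k] is prime to [p], that is, if [k] is the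
    [p]-part of [n]; multiplicativity of [f] then joins the two parts of [n]. *)
Lemma partial_euler_product (s : seq nat) (n : nat) :
  uniq s -> all prime s -> (0 < n)%N ->
  (\big[dirichlet_mul/dirichlet_one]_(p <- s) z p) n =
  if [pred q | q \in s].-nat n then f n else 0%N.
Proof.
elim: s n => [|p s IHs] n /=.
  move=> _ _ n_gt0; rewrite big_nil /dirichlet_one.
  case: eqP => [->|/eqP n1]; first by rewrite f1.
  have n_gt1 : (1 < n)%N by rewrite ltn_neqAle eq_sym n1.
  by case: ifP => // /(pnatP _ n_gt0)/(_ _ (pdiv_prime n_gt1) (pdiv_dvd n)).
case/andP=> ps us /andP[pp ap] n_gt0; rewrite big_cons /dirichlet_mul.
have part_dvd : n`_p %| n by apply: dvdn_part.
have part_cof : (n %/ n`_p = n`_p^')%N.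
  by rewrite -{1}(partnC p n_gt0) mulKn ?part_gt0.
rewrite (bigD1_seq n`_p) ?divisors_uniq -?dvdn_divisors //=.
rewrite big1_seq => [|k /andP[k_part]]; last first.
  rewrite -dvdn_divisors // => kn.
  have k_gt0 : (0 < k)%N by apply: dvdn_gt0 kn.
  rewrite z_pnat //; case: ifP => // pk; rewrite IHs ?divn_gt0 ?(dvdn_leq n_gt0) //.
  case: ifP => [snk|_]; last by rewrite muln0.
  case/eqP: k_part; rewrite -{1}(divnK kn) partnM ?divn_gt0 ?(dvdn_leq n_gt0) //.
  rewrite (part_pnat_id pk) (part_p'nat (n := n %/ k)) ?mul1n //.
  apply: sub_in_pnat snk => q _; rewrite !inE; apply: contraTN => /eqP->.
  by rewrite (negPf ps).
rewrite addn0 z_pnat ?part_gt0 // part_pnat part_cof IHs ?part_gt0 //.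
(* The [p]-part is harmless, and [p] does not divide the remaining part. *)
have -> : [pred q | q \in p :: s].-nat n = [pred q | q \in s].-nat n`_p^'.
  rewrite -{1}(partnC p n_gt0) pnatM.
  have -> /= : [pred q | q \in p :: s].-nat n`_p.
    by apply: sub_in_pnat (part_pnat p n) => q _ /eqP->; rewrite !inE eqxx.
  apply: eq_in_pnat => q qn; rewrite !inE.
  have : q \in p^'.
    move: qn; rewrite mem_primes => /and3P[qp _ qn].
    by apply: (pnatPpi (part_pnat _ n)); rewrite mem_primes qp part_gt0.
  by rewrite !inE => /negPf->.
case: ifP => // _; last by rewrite muln0.
by rewrite -f_coprime ?part_gt0 ?partnC // coprime_partC.
Qed.

Lemma is_prime_product_multiplicative : is_prime_product f z.
Proof.
(* All prime divisors of [n] are at most [n], so [n] itself serves as the threshold. *)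
move=> n n_gt0; exists n => s us aps sn.
rewrite partial_euler_product //; case: ifPn => // /negP[].
by apply/pnatP => // p pp pn; rewrite inE; apply: sn => //; apply: dvdn_leq.
Qed.

End EulerProduct.

(** * Commensurability in finite nilpotent groups *)

Lemma pnat_mul_inj (pi : nat_pred) (a b a' b' : nat) :
  pi.-nat a -> pi^'.-nat b -> pi.-nat a' -> pi^'.-nat b' ->
  (a * b = a' * b')%N -> a = a' /\ b = b'.
Proof.
move=> pa pb pa' pb' e.
have gt0 rho n : rho.-nat n -> (0 < n)%N by case/andP.
have aE x y : pi.-nat x -> pi^'.-nat y -> ((x * y)`_pi = x)%N.
  move=> px py; rewrite partnM ?(gt0 _ _ px) ?(gt0 _ _ py) //.
  by rewrite part_pnat_id // part_p'nat // muln1.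
have ea : a = a' by rewrite -(aE a b) // e aE.
split=> //; move: e; rewrite ea => /eqP; rewrite eqn_pmul2l ?(gt0 pi) //.
by move=> /eqP.
Qed.

Section NilpotentCount.
Local Open Scope group_scope.
Variables (gT : finGroupType) (G : {group gT}).

Definition group_cindex (H K : {group gT}) : nat :=
  (#|H : H :&: K| * #|K : H :&: K|)%N.

(** Lagrange's theorem, applied to both factors. The index is thereby determined by three orders,
    each multiplicative along the decomposition into pi- and pi'-parts. *)
Lemma group_cindex_card (H K : {group gT}) :
  (group_cindex H K * #|H :&: K| ^ 2 = #|H| * #|K|)%N.
Proof.
rewrite /group_cindex expnS expn1 mulnACA.
rewrite (mulnC #|H : _|) (mulnC #|K : _|).
by rewrite (Lagrange (finset.subsetIl H K)) (Lagrange (finset.subsetIr H K)).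
Qed.

Lemma group_cindex_eq1 (H K : {group gT}) : (group_cindex H K == 1%N) = (H == K).
Proof.
rewrite muln_eq1 !indexg_eq1 !finset.subsetI !subxx /= andbT.
by rewrite -val_eqE /= finset.eqEsubset.
Qed.

Lemma group_cindex_pgroup (pi : nat_pred) (H K : {group gT}) :
  pi.-group H -> pi.-group K -> pi.-nat (group_cindex H K).
Proof.
move=> piH piK; rewrite pnatM.
by rewrite !(pnat_dvd (dvdn_indexg _ _)).
Qed.

Definition cindex_groups (L K : {group gT}) (n : nat) : {set {group gT}} :=
  [set H : {group gT} | (H \subset L) && (group_cindex K H == n)].

Lemma card_cindex_groups1 (L K : {group gT}) :
  K \subset L -> #|cindex_groups L K 1| = 1%N.
Proof.
move=> KL; apply/eqP/cards1P; exists K; apply/finset.setP => H.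
rewrite !inE group_cindex_eq1 eq_sym -val_eqE /= andbC.
by case: eqP => //= ->.
Qed.

Hypothesis nilG : nilpotent G.

(** The normal Hall subgroup 'O_pi(G) meets [H] in a Hall subgroup of [H], and in a nilpotent group
    a Hall pi-subgroup is the pi-core. *)
Lemma nilpotent_pcore_sub (pi : nat_pred) (H : {group gT}) :
  H \subset G -> 'O_pi(H) = H :&: 'O_pi(G).
Proof.
move=> HG; have nH : nilpotent H by apply: nilpotentS nilG.
have Hall := setI_normal_Hall (pcore_normal pi G) (nilpotent_pcore_Hall pi nilG) HG.
by rewrite finset.setIC; symmetry; apply: (nilpotent_Hall_pcore nH Hall).
Qed.

(** Taking cores commutes with intersection, and the order of a nilpotent group is the product of
    the orders of its two cores. The identity is checked after multiplication by the square of the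
    order of [H :&: K]. *)
Lemma group_cindex_pcore (pi : nat_pred) (H K : {group gT}) :
  H \subset G -> K \subset G ->
  group_cindex H K =
  (group_cindex 'O_pi(H) 'O_pi(K) * group_cindex 'O_pi^'(H) 'O_pi^'(K))%N.
Proof.
move=> HG KG.
have nil (L : {group gT}) : L \subset G -> nilpotent L by move=> LG; apply: nilpotentS nilG.
have cardE (L : {group gT}) : L \subset G -> (#|'O_pi(L)| * #|'O_pi^'(L)|)%N = #|L|.
  by move=> /nil nL; apply: dprod_card (nilpotent_pcoreC pi nL).
have IE (rho : nat_pred) : 'O_rho(H) :&: 'O_rho(K) = 'O_rho(H :&: K).
  have HKG : H :&: K \subset G by rewrite finset.subIset ?HG.
  rewrite (nilpotent_pcore_sub _ HG) (nilpotent_pcore_sub _ KG).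
  by rewrite (nilpotent_pcore_sub rho (H := (H :&: K)%G) HKG) finset.setIACA finset.setIid.
apply/eqP; rewrite -(@eqn_pmul2r (#|H :&: K| ^ 2)) ?expn_gt0 ?cardG_gt0 //.
rewrite group_cindex_card -(cardE (H :&: K)%G) ?finset.subIset ?HG //= -!IE expnMn.
by rewrite mulnACA !group_cindex_card -(cardE H) // -(cardE K) // mulnACA.
Qed.

(** Sending [H] to its pi-core and pi'-core is a bijection, with inverse [(A, B)] to [A <*> B]. The
    index of [H] splits accordingly, and [pnat_mul_inj] identifies the two factors with [a] and
    [b]. *)
Lemma card_cindex_groups_partn (pi : nat_pred) (K : {group gT}) (a b : nat) :
  K \subset G -> pi.-nat a -> pi^'.-nat b ->
  #|cindex_groups G K (a * b)| =
  (#|cindex_groups 'O_pi(G) 'O_pi(K) a| * #|cindex_groups 'O_pi^'(G) 'O_pi^'(K) b|)%N.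
Proof.
move=> KG pia pib; rewrite -cardsX.
pose split_group (H : {group gT}) := ('O_pi(H)%G, 'O_pi^'(H)%G).
have OG := nilpotent_pcoreC pi nilG.
have pcoreS (rho : nat_pred) (H : {group gT}) :
  H \subset G -> 'O_rho(H) \subset 'O_rho(G).
  by move=> /(nilpotent_pcore_sub rho) ->; apply: finset.subsetIr.
have groupK (H : {group gT}) : H \subset G -> 'O_pi(H) <*> 'O_pi^'(H) = H.
  move=> HG; have nH : nilpotent H by apply: nilpotentS nilG.
  by have /dprodP[_ e c _] := nilpotent_pcoreC pi nH; rewrite cent_joinEr.
rewrite -(card_in_imset (f := split_group)); last first.
  move=> H1 H2; rewrite !inE => /andP[H1G _] /andP[H2G _] [e1 e2].
  by apply: val_inj; rewrite /= -(groupK H1) // -(groupK H2) //= e1 e2.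
congr #|pred_of_set _|; apply/finset.setP => -[A B]; apply/imsetP/idP.
  case=> H; rewrite !inE => /andP[HG /eqP cH] [-> ->] /=.
  rewrite !pcoreS //=; move: cH; rewrite (group_cindex_pcore pi KG HG).
  have p1 : pi.-nat (group_cindex 'O_pi(K)%G 'O_pi(H)%G).
    by apply: group_cindex_pgroup; apply: pcore_pgroup.
  have p2 : pi^'.-nat (group_cindex 'O_pi^'(K)%G 'O_pi^'(H)%G).
    by apply: group_cindex_pgroup; apply: pcore_pgroup.
  by move=> e; have [-> ->] := pnat_mul_inj p1 p2 pia pib e; rewrite !eqxx.
(* Surjectivity: [A] and [B] commute and have coprime orders, so they are Hall subgroups of their
   direct product and hence its cores. *)
rewrite !inE /= => /andP[/andP[AG /eqP cA] /andP[BG /eqP cB]].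
have cAB : B \subset 'C(A).
  by have /dprodP[_ _ c _] := OG; apply: fintype.subset_trans BG (fintype.subset_trans c (centS AG)).
have piA : pi.-group A by apply: pgroupS AG (pcore_pgroup _ _).
have piB : pi^'.-group B by apply: pgroupS BG (pcore_pgroup _ _).
have dAB : A \x B = A <*> B.
  by rewrite dprodEY // coprime_TIg // (pnat_coprime piA).
have ABG : A <*> B \subset G.
  by rewrite join_subG (fintype.subset_trans AG) ?(fintype.subset_trans BG) ?pcore_sub.
have nAB : nilpotent (A <*> B) by apply: nilpotentS ABG nilG.
have cardAB : #|A <*> B| = (#|A| * #|B|)%N by rewrite -(dprod_card dAB).
have eA : A :=: 'O_pi(A <*> B).
  apply: nilpotent_Hall_pcore => //.
  rewrite pHallE joing_subl cardAB partnM ?cardG_gt0 //=.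
  by rewrite (part_pnat_id piA) (part_p'nat piB) muln1.
have eB : B :=: 'O_pi^'(A <*> B).
  apply: nilpotent_Hall_pcore => //.
  rewrite pHallE joing_subr cardAB partnM ?cardG_gt0 //=.
  by rewrite (part_pnat_id piB) part_p'nat ?pnatNK // mul1n.
have eAG : A = 'O_pi(A <*> B)%G by apply: val_inj.
have eBG : B = 'O_pi^'(A <*> B)%G by apply: val_inj.
exists (A <*> B)%G; last by rewrite /split_group; congr (_, _).
rewrite !inE /= ABG (group_cindex_pcore pi) //=.
by rewrite -eAG -eBG cA cB.
Qed.

(** The splitting for the primes of [m] is applied to [m * k], [m * 1] and [1 * k]; in the last two
    one factor counts the subgroups of index 1, and there is exactly one. *)
Lemma card_cindex_groups_coprime (K : {group gT}) (m k : nat) :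
  K \subset G -> (0 < m)%N -> (0 < k)%N -> coprime m k ->
  #|cindex_groups G K (m * k)| = (#|cindex_groups G K m| * #|cindex_groups G K k|)%N.
Proof.
move=> KG m0 k0 mk; pose pi : nat_pred := \pi(m).
have pim : pi.-nat m by apply: pnat_pi.
have pik : pi^'.-nat k by rewrite -coprime_pi'.
have OK (rho : nat_pred) : 'O_rho(K) \subset 'O_rho(G).
  by rewrite (nilpotent_pcore_sub _ KG) finset.subsetIr.
have em := card_cindex_groups_partn KG pim (isT : pi^'.-nat 1%N).
have ek := card_cindex_groups_partn KG (isT : pi.-nat 1%N) pik.
rewrite (card_cindex_groups_partn KG pim pik); move: em ek.
by rewrite !card_cindex_groups1 ?muln1 ?mul1n ?OK // => -> ->.
Qed.

End NilpotentCount.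

Local Open Scope classical_set_scope.
Local Open Scope ring_scope.

(** * Matrix groups and their finite quotients *)

Section Subgroups.
Variables (A : comUnitRingType) (d : nat).
Implicit Types (H K S : set 'M[A]_d) (x y : 'M[A]_d).

Lemma mulVmx_ring x : x \in unitmx -> invmx x * x = 1.
Proof. by move=> ux; rewrite -mulmxE mulVmx. Qed.

Lemma mulmxV_ring x : x \in unitmx -> x * invmx x = 1.
Proof. by move=> ux; rewrite -mulmxE mulmxV. Qed.

Lemma invmx_unique x y : y * x = 1 -> invmx x = y.
Proof.
rewrite -mulmxE => yx; have [_ ux] := mulmx1_unit yx.
by rewrite -[RHS](mulmxK ux) yx mul1mx.
Qed.

Lemma subgroup1 H : is_subgroup H -> H 1.
Proof. by case. Qed.

Lemma subgroupM H x y : is_subgroup H -> H x -> H y -> H (x * y).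
Proof. by case=> _ HM _; apply: HM. Qed.

Lemma subgroupX H x n : is_subgroup H -> H x -> H (x ^+ n).
Proof.
move=> sH Hx; elim: n => [|n IHn]; first by rewrite expr0; apply: subgroup1.
by rewrite exprS; apply: subgroupM.
Qed.

Lemma subgroup_unit H x : is_subgroup H -> H x -> x \in unitmx.
Proof. by case=> _ _ HV /HV[y [_ /mulmx1_unit[]]]. Qed.

Lemma subgroupV H x : is_subgroup H -> H x -> H (invmx x).
Proof.
move=> sH Hx; have ux := subgroup_unit sH Hx.
by case: sH => _ _ /(_ _ Hx)[y [Hy xy _]]; rewrite -(mulKmx ux y) xy mulmx1 in Hy.
Qed.

Lemma subgroupMl H x y : is_subgroup H -> H x -> H (x * y) <-> H y.
Proof.
move=> sH Hx; split=> [Hxy|]; last exact: subgroupM.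
rewrite -(mulKmx (subgroup_unit sH Hx) y).
by apply: subgroupM => //; apply: subgroupV.
Qed.

Lemma is_subgroup_unit H : H `<=` [set x | x \in unitmx] ->
  H 1 -> (forall x y, H x -> H y -> H (x * y)) ->
  (forall x, H x -> H (invmx x)) -> is_subgroup H.
Proof.
move=> Hu H1 HM HV; split=> // x Hx; exists (invmx x).
by rewrite mulmxV ?mulVmx ?Hu //; split=> //; apply: HV.
Qed.

Lemma subgroupI H K : is_subgroup H -> is_subgroup K -> is_subgroup (H `&` K).
Proof.
move=> sH sK; apply: is_subgroup_unit => [x [Hx _]||x y [? ?] [? ?]|x [? ?]].
- exact: subgroup_unit Hx.
- by split; apply: subgroup1.
- by split; apply: subgroupM.
by split; apply: subgroupV.
Qed.

Lemma mem_left_coset K x : is_subgroup K -> (mulmx x @` K) x.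
Proof. by move=> sK; exists 1; rewrite ?mulmx1 //; apply: subgroup1. Qed.

Lemma left_cosetP K x y : is_subgroup K -> x \in unitmx ->
  (mulmx x @` K) y <-> K (invmx x * y).
Proof.
move=> sK ux; split=> [[k Kk <-]|Kxy]; first by rewrite -mulmxE mulKmx.
by exists (invmx x * y) => //; rewrite mulKVmx.
Qed.

Lemma eq_left_coset K x k : is_subgroup K -> K k ->
  mulmx (x * k) @` K = mulmx x @` K.
Proof.
move=> sK Kk; apply/seteqP; split=> _ [l Kl <-].
  by exists (k * l); [apply: subgroupM | rewrite mulmxA].
exists (invmx k * l); first by apply: subgroupM => //; apply: subgroupV.
by rewrite -mulmxA -[_ * l]/(_ *m l) mulKVmx // (subgroup_unit sK).
Qed.

Lemma finite_left_cosets_cover H K (F : seq 'M[A]_d) :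
  is_subgroup K ->
  (forall x, H x -> exists f k, [/\ f \in F, K k & x = f * k]) ->
  finite_set (left_cosets H K).
Proof.
move=> sK cov; apply: (@sub_finite_set _ _ ((fun f => mulmx f @` K) @` [set` F])).
  move=> _ [x /cov[f [k [fF Kk ->]]] <-]; exists f => //.
  by rewrite eq_left_coset.
by apply: finite_image; apply: finite_seq.
Qed.

(** Pigeonhole: two of the [n.+1] powers [x ^+ 0], ..., [x ^+ n] lie in the same coset, so some
    [x ^+ e] with [0 < e <= n] lies in [K], and [e] divides [n]!. *)
Lemma expr_fact_subgroup H K x n :
  is_subgroup H -> is_subgroup K -> finite_set (left_cosets H K) ->
  (subgroup_index H K <= n)%N -> H x -> K (x ^+ n`!).
Proof.
move=> sH sK fin idx Hx.
have ux k : x ^+ k \in unitmx by apply: (subgroup_unit sH); apply: subgroupX.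
pose F (i : 'I_n.+1) := mulmx (x ^+ i) @` K.
have [/injectiveP Finj|] := boolP (injectiveb F).
  suff : (#|` [fset F i | i in 'I_n.+1]%fset| <= n)%N.
    by rewrite card_imfset //= size_enum_ord ltnn.
  apply: leq_trans idx; apply: fsubset_leq_card; apply/fsubsetP=> _ /imfsetP[i _ ->].
  by rewrite in_fset_set // inE; exists (x ^+ i) => //; apply: subgroupX.
case/injectivePn => i [j ij Fij].
wlog lt_ij : i j ij Fij / (i < j)%N.
  move=> wl; case: (ltngtP i j) => [/wl|/wl|/val_inj]; first exact.
    by apply; rewrite 1?eq_sym.
  by move/eqP; rewrite (negPf ij).
have : F i (x ^+ j) by rewrite Fij; apply: mem_left_coset.
rewrite /F (left_cosetP _ sK) // -(subnKC (ltnW lt_ij)) exprD.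
rewrite -mulmxE mulKmx // => Kx.
have /dvdnP[q ->] : (j - i %| n`!)%N.
  apply: dvdn_fact; rewrite subn_gt0 lt_ij /=.
  by apply: leq_trans (leq_subr _ _) _; rewrite -ltnS.
by rewrite mulnC exprM; apply: subgroupX.
Qed.

End Subgroups.

Lemma card_fset_set_image (T : finType) (U : choiceType) (f : T -> U) (S : {set T}) :
  {in S &, injective f} -> #|` fset_set (f @` [set` S])| = #|S|.
Proof.
move=> injf; have fin : finite_set [set` S] by apply: finite_finset.
rewrite fset_set_image // card_in_imfset /=; last first.
  by move=> x y; rewrite !in_fset_set // !inE; apply: injf.
rewrite cardE; apply: perm_size; apply: uniq_perm; rewrite ?fset_uniq ?enum_uniq //.
by move=> x; rewrite in_fset_set // mem_enum; apply/idP/idP; rewrite inE.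
Qed.

(** * The quotient of [L] by [N] as a permutation group *)

Section FiniteQuotient.
Variables (A : comUnitRingType) (d : nat) (L N : set 'M[A]_d).
Hypotheses (sL : is_subgroup L) (sN : is_subgroup N).
Hypothesis nNL : forall x y, L x -> N y -> N (x * y * invmx x).
Hypothesis finLN : finite_set (left_cosets L N).

Definition coset_fset : {fset set 'M[A]_d} := fset_set (left_cosets L N).

Lemma coset_fsetP (C : set 'M[A]_d) :
  C \in coset_fset <-> exists2 x, L x & mulmx x @` N = C.
Proof. by rewrite in_fset_set // inE. Qed.

(** Normality lets right multiplication act on left cosets: [n * y] equals
    [y * (invmx y * n * y)]. *)
Lemma coset_mulr x y : L x -> L y ->
  mulmx^~ y @` (mulmx x @` N) = mulmx (x * y) @` N.
Proof.
move=> Lx Ly; have uy := subgroup_unit sL Ly; apply/seteqP; split.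
  move=> _ [_ [n Nn <-] <-]; exists (invmx y * n * y).
    by rewrite -{2}(invmxK y); apply: nNL => //; apply: subgroupV.
  by rewrite -!mulmxE -!mulmxA mulKVmx.
move=> _ [n Nn <-]; exists (x *m (y * n * invmx y)); first by exists (y * n * invmx y) => //; apply: nNL.
by rewrite -!mulmxE -!mulmxA mulVmx // mulmx1.
Qed.

(** The action is by right multiplication because permutations compose from left to right, so that
    [coset_perm] is a homomorphism on [L]. The default 1 is taken when no permutation agrees with
    this multiplication, which can only happen outside [L]. *)
Definition coset_perm (x : 'M[A]_d) : {perm coset_fset} :=
  odflt 1%g [pick s : {perm coset_fset} |
    [forall C, fsval (s C) == mulmx^~ x @` (fsval C)]].

Lemma coset_permE x (C : coset_fset) : L x ->
  fsval (coset_perm x C) = mulmx^~ x @` (fsval C).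
Proof.
move=> Lx; rewrite /coset_perm; case: pickP => [s /forallP/(_ C)/eqP //|].
have ux := subgroup_unit sL Lx.
have xC (D : coset_fset) : mulmx^~ x @` (fsval D) \in coset_fset.
  have /coset_fsetP[y Ly <-] := fsvalP D; apply/coset_fsetP; exists (y * x).
    exact: subgroupM.
  by rewrite coset_mulr.
(* Multiplication by [invmx x] undoes the map, so it is a permutation of the finite set of
   cosets. *)
have inj_x : injective (fun D => FSetSub (xC D)).
  move=> D1 D2 /(congr1 (fun D => fsval D)) /= e; apply: val_inj => /=.
  have K (E : set 'M[A]_d) : mulmx^~ (invmx x) @` (mulmx^~ x @` E) = E.
    rewrite image_comp -[RHS]image_id; apply: eq_imagel => z _ /=.
    by rewrite mulmxK.
  by rewrite -(K (fsval D1)) e K.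
by move=> /(_ (perm inj_x))/forallP[] D; rewrite permE.
Qed.

Lemma coset_permM x y : L x -> L y ->
  coset_perm (x * y) = (coset_perm x * coset_perm y)%g.
Proof.
move=> Lx Ly; apply/permP => C; apply: val_inj; rewrite permM /=.
rewrite !coset_permE //; last exact: subgroupM.
rewrite image_comp; apply: eq_imagel => z _ /=.
by rewrite mulmxA.
Qed.

(** The coset [N] itself is sent to that of [x], so a trivial action forces [x] into [N]; conversely
    [y * x] and [y] have the same coset when [x] is in [N]. *)
Lemma coset_perm_eq1 x : L x -> coset_perm x = 1%g <-> N x.
Proof.
move=> Lx; have cN : mulmx 1 @` N \in coset_fset.
  by apply/coset_fsetP; exists 1 => //; apply: subgroup1.
split=> [e|Nx].
  have := coset_permE (FSetSub cN) Lx; rewrite e perm1 /= coset_mulr //; last exact: subgroup1.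
  rewrite mul1r => {}e; have : (mulmx x @` N) x by apply: mem_left_coset.
  by rewrite -e => -[n Nn <-]; rewrite mul1mx.
apply/permP => C; apply: val_inj; rewrite perm1 /= coset_permE //.
have /coset_fsetP[y Ly <-] := fsvalP C.
by rewrite coset_mulr // eq_left_coset.
Qed.

Definition coset_perm_set : {set {perm coset_fset}} :=
  [set s | `[< exists2 x, L x & coset_perm x = s >]]%SET.

Lemma coset_perm_setP s :
  reflect (exists2 x, L x & coset_perm x = s) (s \in coset_perm_set).
Proof. by rewrite inE; apply: asboolP. Qed.

Lemma coset_perm_group_set : group_set coset_perm_set.
Proof.
apply/group_setP; split.
  apply/coset_perm_setP; exists 1; first exact: subgroup1.
  by apply/coset_perm_eq1; apply: subgroup1.
move=> _ _ /coset_perm_setP[x Lx <-] /coset_perm_setP[y Ly <-].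
apply/coset_perm_setP; exists (x * y); first exact: subgroupM.
exact: coset_permM.
Qed.

Lemma finite_quotient : exists (gT : finGroupType) (G : {group gT}) (rho : 'M[A]_d -> gT),
  [/\ forall x y, L x -> L y -> rho (x * y) = (rho x * rho y)%g,
      forall x, L x -> rho x = 1%g <-> N x &
      forall g, g \in G <-> exists2 x, L x & rho x = g].
Proof.
exists {perm coset_fset}, (Group coset_perm_group_set), coset_perm; split.
- exact: coset_permM.
- exact: coset_perm_eq1.
by move=> g; split=> /coset_perm_setP.
Qed.

End FiniteQuotient.

(** * Subgroups of the quotient and intermediate subgroups of [L] *)

Section Correspondence.
Variables (A : comUnitRingType) (d : nat) (L N : set 'M[A]_d).
Variables (gT : finGroupType) (G : {group gT}) (rho : 'M[A]_d -> gT).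
Hypothesis sL : is_subgroup L.
Hypothesis rhoM : forall x y, L x -> L y -> rho (x * y) = (rho x * rho y)%g.
Hypothesis rhoN : forall x, L x -> rho x = 1%g <-> N x.
Hypothesis GP : forall g, g \in G <-> exists2 x, L x & rho x = g.

(** Membership in [L] is imposed since nothing is known about [rho] outside [L]. *)
Definition preimage_group (H : {set gT}) : set 'M[A]_d :=
  [set x | L x /\ rho x \in H].

Lemma quotient_map1 : rho 1 = 1%g.
Proof.
by apply: (mulgI (rho 1)); rewrite -rhoM ?mulr1 ?mulg1 //; apply: subgroup1.
Qed.

Lemma quotient_mapV x : L x -> rho (invmx x) = (rho x)^-1%g.
Proof.
move=> Lx; apply: (mulgI (rho x)); rewrite mulgV -rhoM //; last exact: subgroupV.
by rewrite mulmxV_ring ?quotient_map1 // (subgroup_unit sL).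
Qed.

Lemma preimage_group_inj : {in [pred H : {set gT} | H \subset G] &, injective preimage_group}.
Proof.
suff sub (H K : {set gT}) : H \subset G -> preimage_group H `<=` preimage_group K -> H \subset K.
  move=> H K HG KG e; apply/eqP; rewrite finset.eqEsubset.
  by apply/andP; split; apply: sub => //; rewrite e.
move=> HG HK; apply/fintype.subsetP => g gH.
have /GP[x Lx xg] := fintype.subsetP HG _ gH.
by have [_] : preimage_group K x; [apply: HK; split; rewrite ?xg | rewrite xg].
Qed.

Lemma is_subgroup_preimage (H : {group gT}) : is_subgroup (preimage_group H).
Proof.
apply: is_subgroup_unit => [x [Lx _]||x y [Lx Hx] [Ly Hy]|x [Lx Hx]].
- exact: subgroup_unit Lx.
- by split; rewrite ?quotient_map1 ?group1 //; apply: subgroup1.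
- by split; [apply: subgroupM | rewrite rhoM // groupM].
by split; [apply: subgroupV | rewrite quotient_mapV // groupV].
Qed.

Lemma preimage_groupI (H K : {set gT}) :
  preimage_group H `&` preimage_group K = preimage_group (H :&: K)%SET.
Proof.
apply/seteqP; split=> x.
  by case=> -[Lx Hx] [_ Kx]; split; rewrite ?inE ?Hx.
by case=> Lx; rewrite inE => /andP[].
Qed.

Lemma preimage_group_lcoset (H : {set gT}) x : L x ->
  mulmx x @` preimage_group H = preimage_group (rho x *: H)%g.
Proof.
move=> Lx; apply/seteqP; split=> [_ [y [Ly Hy] <-]|y [Ly]].
  by split; [apply: subgroupM | rewrite mulmxE rhoM // mem_lcoset mulKg].
rewrite mem_lcoset => Hy; have LVx := subgroupV sL Lx.
exists (invmx x * y); last by rewrite -mulmxE mulKVmx // (subgroup_unit sL).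
by split; [apply: subgroupM | rewrite rhoM // quotient_mapV].
Qed.

(** Since [rho] maps [L] onto [G], every coset in [G] lifts. This reduces finiteness and the value
    of indices to the finite group. *)
Lemma left_cosets_preimage (H K : {group gT}) : H \subset G ->
  left_cosets (preimage_group H) (preimage_group K) =
  preimage_group @` [set` lcosets K H].
Proof.
move=> HG; apply/seteqP; split=> [_ [x [Lx Hx] <-]|_ [C /lcosetsP[g gH ->] <-]].
  exists (rho x *: K)%g; last by rewrite preimage_group_lcoset.
  by apply/lcosetsP; exists (rho x).
have /GP[x Lx xg] := fintype.subsetP HG _ gH.
exists x; first by split; rewrite ?xg.
by rewrite preimage_group_lcoset // xg.
Qed.

Lemma finite_left_cosets_preimage (H K : {group gT}) : H \subset G ->
  finite_set (left_cosets (preimage_group H) (preimage_group K)).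
Proof.
by move=> HG; rewrite left_cosets_preimage //; apply: finite_image; apply: finite_finset.
Qed.

Lemma subgroup_index_preimage (H K : {group gT}) : H \subset G -> K \subset H ->
  subgroup_index (preimage_group H) (preimage_group K) = #|H : K|%g.
Proof.
move=> HG KH; rewrite /subgroup_index left_cosets_preimage //.
have KG := fintype.subset_trans KH HG.
have cosetG g : g \in H -> (g *: K \subset G)%g.
  by move=> gH; rewrite mul_subG // finset.sub1set (fintype.subsetP HG).
rewrite card_fset_set_image ?card_lcosets //.
move=> _ _ /lcosetsP[g gH ->] /lcosetsP[h hH ->].
by apply: preimage_group_inj; rewrite inE cosetG.
Qed.

Lemma commensurable_preimage (H K : {group gT}) : H \subset G -> K \subset G ->
  commensurable (preimage_group H) (preimage_group K).
Proof.
move=> HG KG; rewrite /commensurable preimage_groupI.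
by split; apply: (@finite_left_cosets_preimage _ (H :&: K)%G).
Qed.

Lemma cindex_preimage (H K : {group gT}) : H \subset G -> K \subset G ->
  cindex (preimage_group H) (preimage_group K) = group_cindex H K.
Proof.
move=> HG KG; rewrite /cindex /group_cindex preimage_groupI.
by congr (_ * _)%N; apply: (@subgroup_index_preimage _ (H :&: K)%G);
  rewrite ?finset.subsetIl ?finset.subsetIr.
Qed.

Lemma preimage_group_surj (D : set 'M[A]_d) : is_subgroup D -> D `<=` L -> N `<=` D ->
  exists2 H : {group gT}, H \subset G & D = preimage_group H.
Proof.
move=> sD DL ND; pose H := [set g | `[< exists2 x, D x & rho x = g >]]%SET.
have HP g : reflect (exists2 x, D x & rho x = g) (g \in H) by rewrite inE; apply: asboolP.
have gH : group_set H.
  apply/group_setP; split.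
    by apply/HP; exists 1; [apply: subgroup1 | apply: quotient_map1].
  move=> _ _ /HP[x Dx <-] /HP[y Dy <-]; apply/HP; exists (x * y).
    exact: subgroupM.
  by apply: rhoM; apply: DL.
exists (Group gH).
  by apply/fintype.subsetP => _ /HP[x Dx <-]; apply/GP; exists x => //; apply: DL.
apply/seteqP; split=> x.
  by move=> Dx; split; [apply: DL | apply/HP; exists x].
(* If [x] has the same image as some [y] in [D], then [invmx y * x] is in the kernel [N], hence in
   [D], and so is [x]. *)
case=> Lx /HP[y Dy e]; have Ly := DL _ Dy; have DVy := subgroupV sD Dy.
apply/(subgroupMl x sD DVy)/ND/rhoN; first by apply: subgroupM => //; apply: DL.
by rewrite rhoM //; [rewrite quotient_mapV // e mulVg | apply: DL].
Qed.

End Correspondence.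

(** * Denominators of powers and roots of unitriangular matrices *)

Section Unitriangular.
Variables (R : realType) (d : nat).
Implicit Types (H K S : set 'M[R]_d) (x y : 'M[R]_d).
Local Notation UT := (unitriangular R d).

Lemma unitriangular1 : UT 1.
Proof. by move=> i j _; rewrite mxE. Qed.

(** The terms [l = j] and [l = i] give the two summands. The remaining sum involves only entries
    strictly closer to the diagonal, which is what the inductions below rely on. *)
Lemma unitriangular_mul_entry x y (i j : 'I_d) : UT x -> UT y -> (j < i)%N ->
  (x * y) i j = x i j + y i j + \sum_(l < d | (j < l < i)%N) x i l * y l j.
Proof.
move=> Ux Uy ji; rewrite -mulmxE mxE (bigD1 j) //= (bigD1 i) /=; last first.
  by rewrite -val_eqE /= gtn_eqF.
rewrite (Ux i i) ?(Uy j j) // !eqxx mulr1 mul1r addrA; congr (_ + _).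
rewrite (bigID (fun l : 'I_d => (j < l < i)%N)) /= [X in _ + X]big1 ?addr0.
  apply: eq_bigl => l; case: (ltnP j l) => //= jl; last by rewrite andbF.
  case: (ltnP l i) => //= li; last by rewrite andbF.
  by rewrite -!val_eqE /= gtn_eqF // ltn_eqF.
move=> l /andP[/andP[lj li]]; rewrite negb_and -!leqNgt => /orP[] h.
  by rewrite (Uy l j) // (negPf lj) mulr0.
by rewrite (Ux i l) // eq_sym (negPf li) mul0r.
Qed.

Lemma unitriangularM x y : UT x -> UT y -> UT (x * y).
Proof.
move=> Ux Uy i j ij; rewrite -mulmxE mxE (bigD1 i) //= (Ux i i) // eqxx mul1r.
rewrite (Uy i j) // big1 ?addr0 // => l li; case: (leqP i l) => il.
  by rewrite (Ux i l) // eq_sym (negPf li) mul0r.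
have lj : (l < j)%N by apply: leq_trans il ij.
by rewrite (Uy l j) ?(ltnW lj) // -val_eqE /= ltn_eqF // mulr0.
Qed.

Lemma unitriangularX x n : UT x -> UT (x ^+ n).
Proof.
move=> Ux; elim: n => [|n IHn]; first exact: unitriangular1.
by rewrite exprS; apply: unitriangularM.
Qed.

(* If the entries of [x] at distance [s < r] below the diagonal have denominator
   dividing [q^(2s-1)], then up to denominator [q^(2s-2)] the entries of [x ^+ k]
   at distance [s <= r] are [k] times those of [x]: the error is a sum of products
   over two or more shorter steps. *)
Lemma unitriangular_expr_entry x (q r k : nat) (i j : 'I_d) : UT x ->
  (forall i j : 'I_d, (j < i)%N -> (i - j < r)%N ->
     x i j * q%:R ^+ (2 * (i - j) - 1) \is a Num.int) ->
  (j < i)%N -> (i - j <= r)%N ->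
  ((x ^+ k) i j - x i j *+ k) * q%:R ^+ (2 * (i - j) - 2) \is a Num.int.
Proof.
move=> Ux xq; elim: k i j => [|k IHk] i j ji ijr.
  by rewrite expr0 mxE -val_eqE /= gtn_eqF // mulr0n subrr mul0r.
rewrite exprS unitriangular_mul_entry //; last exact: unitriangularX.
set e := (_ - 2)%N; rewrite mulrS.
have -> : x i j + (x ^+ k) i j + \sum_(l < d | (j < l < i)%N) x i l * (x ^+ k) l j
    - (x i j + x i j *+ k) = ((x ^+ k) i j - x i j *+ k) +
   \sum_(l < d | (j < l < i)%N) x i l * (x ^+ k) l j by ring.
rewrite mulrDl rpredD ?IHk // mulr_suml rpred_sum // => l /andP[jl li].
have -> : e = ((2 * (i - l) - 1) + (2 * (l - j) - 1))%N by rewrite /e; lia.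
rewrite exprD mulrACA rpredM ?xq //; first by lia.
have -> : (x ^+ k) l j = ((x ^+ k) l j - x l j *+ k) + x l j *+ k by ring.
rewrite mulrDl rpredD //; last by rewrite mulrnAl rpredMn // xq //; lia.
have -> : (2 * (l - j) - 1 = 2 * (l - j) - 2 + 1)%N by lia.
by rewrite exprD expr1 mulrA rpredM ?IHk ?rpred_nat //; lia.
Qed.

Definition integral_mx x := forall i j, x i j \is a Num.int.

(* Conjugation by diag(1, M, M^2, ...) turns this condition into integrality, so
   it is stable under products. *)
Definition graded_integral (M : nat) x :=
  forall i j : 'I_d, (j <= i)%N -> x i j * M%:R ^+ (i - j) \is a Num.int.

(** Induction on the distance [s] to the diagonal: [n] times an entry of [x] is the integral entry
    of [x ^+ n] up to denominator [n^(2s-2)], so the entry has denominator dividing [n^(2s-1)],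
    hence [(n^2)^s]. *)
Lemma graded_integral_root x (n : nat) : UT x -> (0 < n)%N ->
  integral_mx (x ^+ n) -> graded_integral (n ^ 2) x.
Proof.
move=> Ux n_gt0 xn.
have n0 : n%:R != 0 :> R by rewrite pnatr_eq0 -lt0n.
suff lt_int (r : nat) (i j : 'I_d) : (j < i)%N -> (i - j < r)%N ->
    x i j * n%:R ^+ (2 * (i - j) - 1) \is a Num.int.
  move=> i j; rewrite leq_eqVlt => /orP[/eqP/val_inj->|ji].
    by rewrite Ux // eqxx mul1r rpredX // rpred_nat.
  rewrite natrX -exprM.
  have -> : (2 * (i - j) = 2 * (i - j) - 1 + 1)%N by lia.
  by rewrite exprD expr1 mulrA rpredM ?rpred_nat // (lt_int d) //; have := ltn_ord i; lia.
elim: r i j => // r IHr i j ji ijr.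
(* Both the exponent and the denominator base [q] are [n] here. *)
have := unitriangular_expr_entry n Ux IHr ji ijr.
rewrite mulrBl => h; have := rpredM (xn i j) (rpredX (2 * (i - j) - 2) (rpred_nat _ n)).
move=> /rpredB/(_ h); rewrite opprB addrC subrK mulrnAl -mulrnAr -mulr_natr -exprSr.
by have -> : (2 * (i - j) - 2).+1 = (2 * (i - j) - 1)%N by lia.
Qed.

Lemma graded_integral1 M : graded_integral M 1.
Proof.
by move=> i j _; rewrite mxE rpredM ?rpredX ?rpred_nat.
Qed.

Lemma graded_integralM M x y : UT x -> UT y ->
  graded_integral M x -> graded_integral M y -> graded_integral M (x * y).
Proof.
move=> Ux Uy Mx My i j ji; rewrite -mulmxE mxE mulr_suml rpred_sum // => l _.
have [li|il] := leqP l i; last first.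
  by rewrite (Ux i l) 1?ltnW // -val_eqE /= ltn_eqF // !mul0r.
have [jl|lj] := leqP j l; last first.
  by rewrite (Uy l j) 1?ltnW // -val_eqE /= ltn_eqF // mulr0 mul0r.
have -> : (i - j = (i - l) + (l - j))%N by lia.
by rewrite exprD mulrACA rpredM ?Mx ?My.
Qed.

Lemma graded_integralX M x n : UT x -> graded_integral M x -> graded_integral M (x ^+ n).
Proof.
move=> Ux Mx; elim: n => [|n IHn]; first exact: graded_integral1.
by rewrite exprS; apply: graded_integralM => //; apply: unitriangularX.
Qed.

(** One subdiagonal at a time: once the entries of [x ^+ K] at distance less than [r] are integral,
    raising to the power [M ^ r] also clears distance [r]. The exponent is chosen before [x]. *)
Lemma graded_integral_expr (M : nat) : (0 < M)%N -> exists2 K : nat, (0 < K)%N &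
  forall x, UT x -> graded_integral M x -> integral_mx (x ^+ K).
Proof.
move=> M_gt0.
suff H (r : nat) : exists2 K : nat, (0 < K)%N & forall x, UT x ->
    graded_integral M x -> forall i j : 'I_d, (j < i)%N -> (i - j < r)%N ->
    (x ^+ K) i j \is a Num.int.
  have [K K_gt0 hK] := H d; exists K => // x Ux Mx i j; have [ij|ji] := leqP i j.
    by rewrite (unitriangularX K Ux) // rpred_nat.
  by apply: hK => //; have := ltn_ord i; lia.
elim: r => [|r [K K_gt0 hK]]; first by exists 1%N.
exists (K * M ^ r)%N; first by rewrite muln_gt0 K_gt0 expn_gt0 M_gt0.
move=> x Ux Mx i j ji; rewrite ltnS => ijr; rewrite exprM.
have UxK := unitriangularX K Ux; have MxK := graded_integralX K Ux Mx.
(* With [q = 1] the error term of [unitriangular_expr_entry] is integral. *)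
have one_int (i0 j0 : 'I_d) : (j0 < i0)%N -> (i0 - j0 < r)%N ->
    (x ^+ K) i0 j0 * 1%:R ^+ (2 * (i0 - j0) - 1) \is a Num.int.
  by move=> ? ?; rewrite expr1n mulr1 hK.
have := unitriangular_expr_entry (M ^ r) UxK one_int ji ijr.
rewrite expr1n mulr1 => h; rewrite -[X in X \is a _](subrK ((x ^+ K) i j *+ M ^ r)).
apply: rpredD => //; rewrite -mulr_natr natrX -(subnKC ijr) exprD mulrA.
by rewrite rpredM ?rpredX ?rpred_nat // MxK // ltnW.
Qed.

End Unitriangular.

(** * Filtrations of unitriangular groups *)

Section Filtrations.
Variables (R : realType) (d : nat).
Implicit Types (H K S L : set 'M[R]_d) (x y : 'M[R]_d).
Local Notation UT := (unitriangular R d).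

(** Positions are numbered in row-major order, so that raising [t] by one constrains a single entry
    and successive quotients of unitriangular groups embed in the additive group of [R]. *)
Definition lex_trivial (t : nat) x :=
  forall i j : 'I_d, (i * d + j < t)%N -> x i j = (i == j)%:R.

Lemma lex_trivial_eq1 x : lex_trivial (d * d) x -> x = 1.
Proof.
move=> tx; apply/matrixP => i j; rewrite tx ?mxE //.
by have := ltn_ord i; have := ltn_ord j; nia.
Qed.

(** Each correction term contains an entry [y l j] with [j < l < i]; it lies in an earlier row,
    before position [t], and so vanishes. *)
Lemma lex_trivialM_entry t x y (i j : 'I_d) : UT x -> UT y ->
  lex_trivial t y -> (i * d + j <= t)%N -> (j < i)%N ->
  (x * y) i j = x i j + y i j.
Proof.
move=> Ux Uy ty ijt ji; rewrite unitriangular_mul_entry // big1 ?addr0 // => l.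
move=> /andP[jl li]; rewrite (ty l j) -?val_eqE /= ?gtn_eqF ?mulr0 //.
by apply: leq_trans ijt; have := ltn_ord j; nia.
Qed.

Lemma lex_trivialM t x y : UT x -> UT y ->
  lex_trivial t x -> lex_trivial t y -> lex_trivial t (x * y).
Proof.
move=> Ux Uy tx ty i j ijt; have [ij|ji] := leqP i j.
  by rewrite (unitriangularM Ux Uy).
rewrite (lex_trivialM_entry Ux Uy ty) // ?(ltnW ijt) // tx // ty //.
by rewrite -val_eqE /= gtn_eqF // addr0.
Qed.

Lemma lex_trivialX t x n : UT x -> lex_trivial t x -> lex_trivial t (x ^+ n).
Proof.
move=> Ux tx; elim: n => [|n IHn]; first by move=> i j _; rewrite mxE.
by rewrite exprS; apply: lex_trivialM => //; apply: unitriangularX.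
Qed.

Lemma lex_trivialX_entry t x n (i j : 'I_d) : UT x -> lex_trivial t x ->
  (i * d + j <= t)%N -> (j < i)%N -> (x ^+ n) i j = x i j *+ n.
Proof.
move=> Ux tx ijt ji; elim: n => [|n IHn].
  by rewrite expr0 mxE -val_eqE /= gtn_eqF.
rewrite exprS (lex_trivialM_entry (t := t)) ?IHn ?mulrS //; last exact: lex_trivialX.
exact: unitriangularX.
Qed.

Lemma lex_trivialV t x y : UT x -> UT y -> x * y = 1 ->
  lex_trivial t x -> lex_trivial t y.
Proof.
move=> Ux Uy xy; elim: t => [//|t IHt] tx i j ijt.
have tx' : lex_trivial t x by move=> i0 j0 h; apply: tx; apply: ltnW.
have [ij|ji] := leqP i j; first by rewrite Uy.
have := lex_trivialM_entry Ux Uy (IHt tx') ijt ji.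
by rewrite xy mxE tx // -val_eqE /= gtn_eqF // add0r.
Qed.

(* Rows are cleared from top to bottom: on the matrices of [L] which are trivial
   before position [t] in row-major order, the entry at [t] is additive, and it
   takes finitely many values modulo its values on [S]. *)
Lemma finite_left_cosets_expr L S (B K : nat) :
  is_subgroup L -> is_subgroup S -> L `<=` UT -> S `<=` L -> (0 < B)%N -> (0 < K)%N ->
  (forall x i j, L x -> x i j * B%:R \is a Num.int) ->
  (forall x, L x -> S (x ^+ K)) ->
  finite_set (left_cosets L S).
Proof.
move=> sL sS LU SL B_gt0 K_gt0 LB LK.
suff [F cov] : exists F : seq 'M[R]_d, forall x, L x -> lex_trivial 0 x ->
    exists f k, [/\ f \in F, S k & x = f * k].
  by apply: (finite_left_cosets_cover (F := F)) => // x Lx; apply: cov.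
pose covered t := exists F : seq 'M[R]_d, forall x, L x -> lex_trivial t x ->
    exists f k, [/\ f \in F, S k & x = f * k].
(* Descending induction on the position, starting from [d * d], where only the identity is left. *)
suff cov_sub s : (s <= d * d)%N -> covered (d * d - s)%N.
  by have := cov_sub _ (leqnn _); rewrite subnn.
elim: s => [_|s IHs sd].
  rewrite subn0; exists [:: 1] => x Lx /lex_trivial_eq1->; exists 1, 1.
  by rewrite mem_seq1 mulr1; split=> //; apply: subgroup1.
have [F cov] := IHs (ltnW sd); pose t := (d * d - s.+1)%N.
rewrite -/t; have tS : (d * d - s = t.+1)%N by rewrite /t; lia.
rewrite tS in cov.
have d_gt0 : (0 < d)%N by case: (d) sd.
have td : (t < d * d)%N by rewrite /t; lia.
have it : (t %/ d < d)%N by rewrite ltn_divLR.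
pose i := Ordinal it; pose j := Ordinal (ltn_pmod t d_gt0).
have ijt : (i * d + j = t)%N by rewrite /= -divn_eq.
have lexS x : lex_trivial t x -> x i j = (i == j)%:R -> lex_trivial t.+1 x.
  move=> tx xij i' j'; rewrite ltnS leq_eqVlt => /orP[/eqP e|]; last exact: tx.
  suff [-> ->] : i' = i /\ j' = j by [].
  by split; apply: val_inj; rewrite /= -e ?divnMDl ?modnMDl ?divn_small ?modn_small ?addn0.
have [triv|/existsNP[g /not_implyP[Lg /not_implyP[tg gij]]]] :=
  pselect (forall x, L x -> lex_trivial t x -> x i j = (i == j)%:R).
  by exists F => x Lx tx; apply: cov => //; apply: lexS => //; apply: triv.
have ji : (j < i)%N by rewrite ltnNge; apply/negP => ij; case: gij; apply: (LU g Lg).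
have ij0 : (i == j) = false by rewrite -val_eqE /= gtn_eqF.
have ijt' : (i * d + j <= t)%N by rewrite ijt.
have UTg := LU _ Lg.
(* Some [g] has a nonzero entry at position [t]; its power [h] is in [S], and the entry of [h] there
   is [K] times that of [g]. *)
pose h := g ^+ K; have Sh : S h by apply: LK.
have hV : h * invmx h = 1 by rewrite mulmxV_ring // (subgroup_unit sS Sh).
have th : lex_trivial t h by apply: lex_trivialX.
have Uh : UT h by apply: unitriangularX.
have UVh : UT (invmx h) by apply: LU; apply: SL; apply: subgroupV.
have tVh := lex_trivialV Uh UVh hV th.
have hVij : (invmx h) i j = - h i j.
  have := lex_trivialM_entry Uh UVh tVh ijt' ji.
  by rewrite hV mxE ij0 => /esym/eqP; rewrite addrC addr_eq0 => /eqP.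
have hij : h i j = g i j *+ K by apply: (lex_trivialX_entry _ UTg tg).
have /intrP[b bE] := LB g i j Lg.
have b0 : b != 0.
  apply/eqP => b0; move/eqP: bE; rewrite b0 mulf_eq0 pnatr_eq0 -[B == _]negbK -lt0n.
  by rewrite B_gt0 orbF => /eqP g0; case: gij; rewrite g0 ij0.
pose m := (b * K%:Z)%R.
have m0 : m != 0 by rewrite mulf_neq0 // eqz_nat -lt0n.
have hm : h i j * B%:R = m%:~R by rewrite hij mulrnAl bE /m intrM mulr_natr.
(* Multiplied by [B], the entries at position [t] are integers and that of [h] is [m]. One
   representative is chosen for each residue modulo [m] that occurs, and 1 for the others. *)
pose is_rep (r : nat) y := [/\ L y, lex_trivial t y &
   exists q : int, y i j * B%:R = (q * m + r%:Z)%:~R].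
have /choice[rep repP] : forall r, exists y, (exists z, is_rep r z) -> is_rep r y.
  by move=> r; have [[z rz]|no] := pselect (exists z, is_rep r z);
    [exists z | exists 1].
exists [seq rep r * f | r <- iota 0 `|m|%N, f <- F] => x Lx tx.
have /intrP[z zE] := LB x i j Lx.
pose r := `|(z %% m)%Z|%N.
have rE : r%:Z = (z %% m)%Z by rewrite /r gez0_abs // modz_ge0.
have rm : (r < `|m|)%N by rewrite -ltz_nat rE abszE ltz_mod.
have [|Ly ty [q yE]] := repP r.
  by exists x; split=> //; exists (z %/ m)%Z; rewrite zE rE -divz_eq.
pose y := rep r; rewrite -/y in Ly ty yE.
have Uy := LU _ Ly; have uy := subgroup_unit sL Ly.
have LVy := subgroupV sL Ly; have UVy := LU _ LVy.
have yV : y * invmx y = 1 by rewrite mulmxV_ring.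
have tVy := lex_trivialV Uy UVy yV ty.
pose w := invmx y * x.
have Lw : L w by apply: subgroupM.
have tw : lex_trivial t w by apply: lex_trivialM => //; apply: LU.
have yw : y * w = x by rewrite /w -mulmxE mulKVmx.
have wij : w i j = h i j *~ ((z %/ m)%Z - q).
  have := lex_trivialM_entry Uy (LU _ Lw) tw ijt' ji; rewrite yw => e.
  have B0 : B%:R != 0 :> R by rewrite pnatr_eq0 -lt0n.
  apply: (mulIf B0); rewrite mulrzAl hm -mulrzr -intrM.
  have -> : w i j = x i j - y i j by rewrite e addrC addKr.
  rewrite mulrBl zE yE {1}(divz_eq z m) -rE -intrB; congr _%:~R; ring.
(* The entry of [w] is an integral multiple of that of [h], so a power of [h] or of its inverse
   cancels it, and [w * v] falls under the induction hypothesis. *)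
have [v [Sv Uv tv vij]] : exists v, [/\ S v, UT v, lex_trivial t v & v i j = - w i j].
  rewrite wij; case: (_ - q) => n.
    exists (invmx h ^+ n); split; first by apply: (subgroupX _ sS); apply: (subgroupV sS).
    - exact: unitriangularX.
    - exact: lex_trivialX.
    by rewrite (lex_trivialX_entry _ UVh tVh) // hVij mulNrn.
  exists (h ^+ n.+1); split; first exact: (subgroupX _ sS).
  - exact: unitriangularX.
  - exact: lex_trivialX.
  by rewrite (lex_trivialX_entry _ Uh th) // NegzE mulrNz opprK.
have Lv := SL _ Sv.
have [||f [k [fF Sk e]]] := cov (w * v).
- exact: subgroupM.
- apply: lexS; first by apply: lex_trivialM => //; apply: LU.
  by rewrite (lex_trivialM_entry (LU _ Lw) Uv tv) // vij subrr ij0.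
exists (y * f), (k * invmx v); split.
- by apply/allpairsP; exists (r, f); rewrite mem_iota /=.
- by apply: subgroupM => //; apply: subgroupV.
rewrite mulrA -(mulrA y) -e mulrA yw -!mulmxE.
by rewrite mulmxK // (subgroup_unit sL Lv).
Qed.

(* The group of matrices [x] with [diagonal_trivial t (x - 1)] is the [t]-th term
   of the lower central series of the unitriangular group. *)
Definition diagonal_trivial (t : nat) x :=
  forall i j : 'I_d, (i < j + t)%N -> x i j = 0.

Lemma diagonal_trivialM s t x y :
  diagonal_trivial s x -> diagonal_trivial t y -> diagonal_trivial (s + t) (x * y).
Proof.
move=> sx ty i j ij; rewrite -mulmxE mxE big1 // => l _.
have [il|li] := ltnP i (l + s); first by rewrite sx // mul0r.
by rewrite (ty l j) ?mulr0 //; lia.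
Qed.

Lemma diagonal_trivialB t x y :
  diagonal_trivial t x -> diagonal_trivial t y -> diagonal_trivial t (x - y).
Proof. by move=> tx ty i j ij; rewrite !mxE tx // ty // subrr. Qed.

Lemma diagonal_trivialD t x y :
  diagonal_trivial t x -> diagonal_trivial t y -> diagonal_trivial t (x + y).
Proof. by move=> tx ty i j ij; rewrite !mxE tx // ty // addr0. Qed.

Lemma unitriangular_diagonal x : UT x -> diagonal_trivial 1 (x - 1).
Proof. by move=> Ux i j; rewrite addn1 ltnS => ij; rewrite !mxE Ux // subrr. Qed.

Lemma diagonal_trivial0 x : UT x -> diagonal_trivial 0 x.
Proof. by move=> Ux i j; rewrite addn0 => ij; rewrite Ux 1?ltnW // -val_eqE /= ltn_eqF. Qed.

(** Nilpotency is tested on subgroups [H] contained in their commutator with [G]. Commutation with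
    [G] raises the level in the lower central filtration, so [H] lies in the image of every level,
    and level [d] is trivial. *)
Lemma nilpotent_quotient L (gT : finGroupType) (G : {group gT}) (rho : 'M[R]_d -> gT) :
  is_subgroup L -> L `<=` UT ->
  (forall x y, L x -> L y -> rho (x * y) = (rho x * rho y)%g) ->
  (forall g, g \in G <-> exists2 x, L x & rho x = g) ->
  nilpotent G.
Proof.
move=> sL LU rhoM GP.
have rho1 : rho 1 = 1%g.
  by apply: (mulgI (rho 1)); rewrite -rhoM ?mulr1 ?mulg1 //; apply: subgroup1.
have rhoV x : L x -> rho (invmx x) = (rho x)^-1%g.
  move=> Lx; apply: (mulgI (rho x)); rewrite mulgV -rhoM //; last exact: subgroupV.
  by rewrite mulmxV_ring // (subgroup_unit sL).
apply/forallP => H; apply/implyP; rewrite finset.subsetI => /andP[HG HHG].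
pose level t := [set g : gT | `[< exists2 x, L x /\ diagonal_trivial t (x - 1) & rho x = g >]]%SET.
have levelP t g : reflect (exists2 x, L x /\ diagonal_trivial t (x - 1) & rho x = g)
    (g \in level t) by rewrite inE; apply: asboolP.
have level_group t : group_set (level t).
  apply/group_setP; split.
    apply/levelP; exists 1 => //; split; first exact: subgroup1.
    by move=> i j _; rewrite subrr mxE.
  move=> _ _ /levelP[x [Lx tx] <-] /levelP[y [Ly ty] <-].
  apply/levelP; exists (x * y); last exact: rhoM.
  split; first exact: subgroupM.
  have -> : x * y - 1 = x * (y - 1) + (x - 1).
    by rewrite mulrBr mulr1 addrA subrK.
  apply: diagonal_trivialD => //; rewrite -[t]add0n.
  by apply: diagonal_trivialM => //; apply: diagonal_trivial0; apply: LU.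
have Hlevel t : H \subset level t.
  elim: t => [|t IHt].
    apply/fintype.subsetP => g /(fintype.subsetP HG)/GP[x Lx <-]; apply/levelP; exists x => //.
    split=> // i j ij; apply: unitriangular_diagonal; first exact: LU.
    by apply: leq_trans ij _; rewrite addn0 addn1.
  apply: fintype.subset_trans HHG _; rewrite -[level _]/(Group (level_group t.+1) : {set gT}).
  rewrite gen_subG; apply/fintype.subsetP => _ /imset2P[g h gH hG ->].
  have /levelP[x [Lx tx] <-] := fintype.subsetP IHt _ gH.
  have /GP[y Ly <-] := hG.
  have LVx := subgroupV sL Lx; have LVy := subgroupV sL Ly.
  have Lyx := subgroupM sL LVx LVy.
  apply/levelP; exists (invmx x * invmx y * (x * y)).
    split; first by do 2?apply: subgroupM.
    have xV : x * invmx x = 1 by rewrite mulmxV_ring // (subgroup_unit sL).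
    have Vx : invmx x * x = 1 by rewrite mulVmx_ring // (subgroup_unit sL).
    have Vy : invmx y * y = 1 by rewrite mulVmx_ring // (subgroup_unit sL).
    (* In this form the commutator visibly has level [t.+1], since [x - 1] has level [t] and [y - 1]
       level 1. *)
    have -> : invmx x * invmx y * (x * y) - 1 =
        invmx x * invmx y * ((x - 1) * (y - 1) - (y - 1) * (x - 1)).
      have -> : (x - 1) * (y - 1) - (y - 1) * (x - 1) = x * y - y * x.
        have e u v : (u - 1) * (v - 1) = u * v - (u + v - 1) :> 'M[R]_d.
          rewrite mulrBr mulr1 mulrBl mul1r -addrA -opprD.
          by rewrite [u + v]addrC addrA.
        have subBB u v w : (u - w) - (v - w) = u - v :> 'M[R]_d.
          by rewrite opprB addrA subrK.
        by rewrite !e [y + x]addrC subBB.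
      by rewrite mulrBr -(mulrA _ _ (y * x)) (mulrA _ y) Vy mul1r Vx.
    rewrite -[t.+1]add0n; apply: diagonal_trivialM; first by apply: diagonal_trivial0; apply: LU.
    have ty := unitriangular_diagonal (LU _ Ly).
    apply: diagonal_trivialB; first by rewrite -addn1; apply: diagonal_trivialM.
    by rewrite -add1n; apply: diagonal_trivialM.
  rewrite !rhoM ?rhoV //; last exact: subgroupM.
  by rewrite /commg /conjg !mulgA.
apply/eqP/trivgP; apply: fintype.subset_trans (Hlevel d) _.
apply/fintype.subsetP => _ /levelP[x [_ dx] <-].
have -> : x = 1; last by rewrite rho1 inE.
apply/eqP; rewrite -subr_eq0; apply/eqP/matrixP => i j.
by rewrite dx ?mxE // ltn_addl.
Qed.

End Filtrations.

(** * Lattices in unipotent groups *)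

Lemma mmap_intr_rmorph (A B : comNzRingType) (f : {rmorphism A -> B}) (n : nat)
    (h : 'I_n -> A) (p : mpoly.mpoly n int) :
  mpoly.mmap (intr : int -> B) (f \o h) p = f (mpoly.mmap (intr : int -> A) h p).
Proof.
rewrite /mpoly.mmap rmorph_sum /=; apply: eq_bigr => m _.
rewrite rmorphM rmorph_int; congr (_ * _).
by rewrite /mpoly.mmap1 rmorph_prod; apply: eq_bigr => i _; rewrite rmorphXn.
Qed.

(** Evaluation of integral polynomials commutes with [f], and injectivity reflects equations. For
    integers inside [R], this identifies G(Z) with the real points having integral entries. *)
Lemma zero_locus_map_mx (A B : comNzRingType) (f : {rmorphism A -> B}) (d : nat)
    (E : set (mpoly.mpoly (d * d) int)) (X : 'M[A]_d) :
  injective f -> zero_locus E B (map_mx f X) <-> zero_locus E A X.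
Proof.
move=> injf; have evE p : eval_mx (map_mx f X) p = f (eval_mx X p).
  rewrite /eval_mx -mmap_intr_rmorph; congr (mpoly.mmap _ _ _).
  by apply/funext => k; rewrite /= -map_mxvec mxE.
split=> -[UX EX]; split=> [i j ij|p Ep].
- by apply: injf; rewrite rmorph_nat -(UX i j ij) mxE.
- by apply: injf; rewrite rmorph0 -evE EX.
- by rewrite mxE UX // rmorph_nat.
by rewrite evE EX // rmorph0.
Qed.

Section IntegralPoints.
Variables (R : realType) (d : nat) (G : unipotent_Zgroup d).
Local Notation GZ := (integral_points R G).

Lemma points_unitriangular : points G R `<=` unitriangular R d.
Proof. by move=> x []. Qed.

Lemma integral_pointsP x : GZ x <-> points G R x /\ integral_mx x.
Proof.
have inj_intr : injective (intr : int -> R) by apply: intr_inj.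
split=> [[X GX <-]|[Gx xint]].
  split; first by apply/(@zero_locus_map_mx int R intr).
  by move=> i j; rewrite mxE; apply/intrP; exists (X i j).
have /choice[F FE] i : exists z : 'I_d -> int, forall j, x i j = (z j)%:~R.
  have /choice[z zE] j : exists z : int, x i j = z%:~R by apply/intrP.
  by exists z.
have xE : map_mx intr (\matrix_(i, j) F i j) = x.
  by apply/matrixP => i j; rewrite !mxE FE.
exists (\matrix_(i, j) F i j) => //.
by apply/(@zero_locus_map_mx int R intr) => //; rewrite /= xE.
Qed.

Lemma is_subgroup_points : is_subgroup (points G R).
Proof. exact: zero_locus_subgroup. Qed.

Lemma is_subgroup_integral_points : is_subgroup GZ.
Proof.
have [G1 GM GV] : is_subgroup (points G int) by apply: zero_locus_subgroup.
split=> [|_ _ [X GX <-] [Y GY <-]|_ [X GX <-]].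
- by exists 1%:M => //; rewrite map_mx1.
- by exists (X *m Y); [apply: GM | rewrite map_mxM].
have [Y [GY XY YX]] := GV X GX; exists (map_mx intr Y).
by split; [exists Y | rewrite -map_mxM XY map_mx1 | rewrite -map_mxM YX map_mx1].
Qed.

(** Imposing the condition on the inverse too makes closure under inversion immediate. *)
Definition enveloping_group (M : nat) : set 'M[R]_d :=
  [set x | [/\ points G R x, graded_integral M x & graded_integral M (invmx x)]].

Lemma is_subgroup_enveloping M : is_subgroup (enveloping_group M).
Proof.
have sG := is_subgroup_points; have U := points_unitriangular.
apply: is_subgroup_unit => [x [Gx _ _]||x y [Gx Mx MVx] [Gy My MVy]|x [Gx Mx MVx]].
- exact: subgroup_unit Gx.
- split; [exact: subgroup1 | exact: graded_integral1|].
  by rewrite invmx1; apply: graded_integral1.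
- split; first exact: subgroupM.
    by apply: graded_integralM => //; apply: U.
  have -> : invmx (x * y) = invmx y * invmx x.
    have ux := subgroup_unit sG Gx; have uy := subgroup_unit sG Gy.
    by apply: invmx_unique; rewrite -mulrA (mulrA _ x) !(mulVmx_ring, mul1r).
  by apply: graded_integralM => //; apply: U; apply: subgroupV.
by split; rewrite ?invmxK //; apply: subgroupV.
Qed.

(** The generated subgroup is taken as an intersection, so its minimality needs no words in the
    generators. *)
Definition power_subgroup (L : set 'M[R]_d) (K : nat) : set 'M[R]_d :=
  [set x | forall S, is_subgroup S -> (forall y, L y -> S (y ^+ K)) -> S x].

Lemma power_subgroup_sub L K S : is_subgroup S ->
  (forall y, L y -> S (y ^+ K)) -> power_subgroup L K `<=` S.
Proof. by move=> sS LS x; apply. Qed.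

Lemma power_subgroup_expr L K y : L y -> power_subgroup L K (y ^+ K).
Proof. by move=> Ly S _; apply. Qed.

Lemma is_subgroup_power L K : is_subgroup L -> is_subgroup (power_subgroup L K).
Proof.
move=> sL; have LL y : L y -> L (y ^+ K) by apply: subgroupX.
apply: is_subgroup_unit => [x Nx|S sS _|x y Nx Ny S sS LS|x Nx S sS LS].
- exact: (subgroup_unit sL (Nx _ sL LL)).
- exact: subgroup1.
- by apply: subgroupM => //; [apply: Nx | apply: Ny].
by apply: subgroupV => //; apply: Nx.
Qed.

Lemma conj_expr (g y : 'M[R]_d) k : g \in unitmx ->
  (g * y * invmx g) ^+ k = g * y ^+ k * invmx g.
Proof.
move=> ug; have gV := mulVmx_ring ug.
elim: k => [|k IHk]; first by rewrite !expr0 mulr1 mulmxV_ring.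
by rewrite !exprS IHk -!mulrA (mulrA (invmx g)) gV mul1r.
Qed.

Lemma power_subgroup_normal L K g y : is_subgroup L -> L g ->
  power_subgroup L K y -> power_subgroup L K (g * y * invmx g).
Proof.
move=> sL Lg Ny S sS LS; have ug := subgroup_unit sL Lg.
have gV := mulVmx_ring ug.
have Vg := mulmxV_ring ug.
have LL z : L z -> L (z ^+ K) by apply: subgroupX.
suff [] : [set x | L x /\ S (g * x * invmx g)] y by [].
(* The elements of [L] whose conjugate by [g] lies in [S] form a subgroup. It contains the [K]-th
   powers because conjugates of powers are powers of conjugates. *)
apply: (Ny [set x | L x /\ S (g * x * invmx g)]) => [|z Lz]; last first.
  split; first exact: LL.
  rewrite -conj_expr //; apply: LS.
  by do !apply: subgroupM => //; apply: subgroupV.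
apply: is_subgroup_unit => [x [Lx _]||x z [Lx Sx] [Lz Sz]|x [Lx Sx]].
- exact: subgroup_unit Lx.
- by split; [apply: subgroup1 | rewrite mulr1 Vg; apply: subgroup1].
- split; first exact: subgroupM.
  have -> : g * (x * z) * invmx g = (g * x * invmx g) * (g * z * invmx g).
    by rewrite -!mulrA (mulrA (invmx g)) gV mul1r.
  exact: subgroupM.
split; first exact: subgroupV.
have ux := subgroup_unit sL Lx.
have <- : invmx (g * x * invmx g) = g * invmx x * invmx g; last exact: subgroupV.
apply: invmx_unique.
by rewrite -!mulrA (mulrA (invmx g)) gV mul1r (mulrA (invmx x)) mulVmx_ring ?mul1r.
Qed.

Lemma cindexC (A : comNzRingType) (D E : set 'M[A]_d) : cindex D E = cindex E D.
Proof. by rewrite /cindex setIC mulnC. Qed.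

Lemma subgroup_index_gt0 (D E : set 'M[R]_d) : is_subgroup D ->
  finite_set (left_cosets D E) -> (0 < subgroup_index D E)%N.
Proof.
move=> sD fin; rewrite cardfs_gt0; apply/fset0Pn; exists (mulmx 1 @` E).
by rewrite in_fset_set // inE; exists 1 => //; apply: subgroup1.
Qed.

Lemma lattice_bounds (n : nat) : exists L N : set 'M[R]_d,
  [/\ [/\ is_subgroup L, is_subgroup N, N `<=` L & L `<=` points G R],
      forall x y, L x -> N y -> N (x * y * invmx x),
      finite_set (left_cosets L N), N `<=` GZ /\ GZ `<=` L &
      forall D, lattices R G D -> (cindex GZ D <= n)%N -> N `<=` D /\ D `<=` L].
Proof.
(* The square comes from [graded_integral_root], applied to [n]!-th roots of integral matrices. *)
pose M := (n`! ^ 2)%N; pose L := enveloping_group M.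
have sL : is_subgroup L by apply: is_subgroup_enveloping.
have sG := is_subgroup_points; have sZ := is_subgroup_integral_points.
have LG : L `<=` points G R by move=> x [].
have LU : L `<=` unitriangular R d by move=> x /LG/points_unitriangular.
have M_gt0 : (0 < M)%N by rewrite expn_gt0 fact_gt0.
have [K1 K1_gt0 LK1] := graded_integral_expr R d M_gt0.
have LZ x : L x -> GZ (x ^+ K1).
  move=> Lx; apply/integral_pointsP; split; first by apply: subgroupX => //; apply: LG.
  by apply: LK1; [apply: LU | case: Lx].
have ML x : points G R x -> GZ (x ^+ n`!) -> graded_integral M x.
  move=> Gx /integral_pointsP[_ xint]; apply: graded_integral_root => //.
    exact: points_unitriangular.
  exact: fact_gt0.
have subL D : is_subgroup D -> D `<=` points G R -> (forall x, D x -> GZ (x ^+ n`!)) -> D `<=` L.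
  move=> sD DG DZ x Dx; have DVx := subgroupV sD Dx.
  by split; [apply: DG | apply: ML; [apply: DG | apply: DZ] ..].
(* The power [K1] takes [L] into G(Z), and the further power [n]! takes G(Z) into each lattice of
   index at most [n]. *)
pose K := (K1 * n`!)%N; pose N := power_subgroup L K.
have K_gt0 : (0 < K)%N by rewrite muln_gt0 K1_gt0 fact_gt0.
have sN : is_subgroup N by apply: is_subgroup_power.
have NL : N `<=` L by apply: power_subgroup_sub => // y; apply: subgroupX.
exists L, N; split=> //.
- by move=> x y; apply: power_subgroup_normal.
(* [M ^ d] is a common denominator, as [i - j] never exceeds [d]. *)
- apply: (finite_left_cosets_expr (B := (M ^ d)%N) (K := K)) => //.
  + by rewrite expn_gt0 M_gt0.
  + move=> x i j Lx; have [ij|ji] := leqP i j.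
      by rewrite (LU x Lx) // rpredM ?rpred_nat.
    have [_ Mx _] := Lx; have id := ltn_ord i.
    have e : M%:R ^+ d = M%:R ^+ (i - j) * M%:R ^+ (d - (i - j)) :> R.
      by rewrite -exprD subnKC //; lia.
    by rewrite natrX e mulrA rpredM ?rpredX ?rpred_nat // Mx // ltnW.
  by move=> x; apply: power_subgroup_expr.
- split; last by apply: subL => // [x /integral_pointsP[]//|x Zx]; apply: subgroupX.
  by apply: power_subgroup_sub => // y Ly; rewrite exprM; apply: subgroupX => //; apply: LZ.
move=> D [sD DG [finD finZ]] le_n.
have sDZ := subgroupI sD sZ.
rewrite setIC in le_n finZ; rewrite /cindex in le_n.
(* Both indices are finite, hence positive, so each is bounded by their product and thus by [n]. *)
have gtZ : (0 < subgroup_index GZ (GZ `&` D))%N by apply: subgroup_index_gt0.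
have sZD := subgroupI sZ sD.
have finD' : finite_set (left_cosets D (GZ `&` D)) by rewrite setIC.
have gtD : (0 < subgroup_index D (GZ `&` D))%N by apply: subgroup_index_gt0.
split.
  apply: power_subgroup_sub => // y Ly; rewrite exprM.
  have [] // := expr_fact_subgroup (n := n) sZ sZD finZ _ (LZ _ Ly).
  by apply: leq_trans le_n; rewrite leq_pmulr.
apply: subL => // x Dx.
have [] // := expr_fact_subgroup (n := n) sD sZD finD' _ Dx.
by apply: leq_trans le_n; rewrite leq_pmull.
Qed.

(** A single finite group serves all indices up to [n], which allows the counts for [m], [k] and
    [m * k] to be compared inside it. *)
Lemma lattices_quotient (n : nat) :
  exists (gT : finGroupType) (Q P : {group gT}),
  [/\ nilpotent Q, P \subset Q &
    forall m, (0 < m <= n)%N -> finite_set (of_cindex G (lattices R G) m) /\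
      zeta G (lattices R G) m = #|cindex_groups Q P m|].
Proof.
have [L [N [[sL sN NL LG] nNL finLN [NZ ZL] bnd]]] := lattice_bounds n.
have LU : L `<=` unitriangular R d by move=> x /LG/points_unitriangular.
have [gT [Q [rho [rhoM rhoN QP]]]] := finite_quotient sL sN nNL finLN.
have [P PQ ZP] := preimage_group_surj sL rhoM rhoN QP is_subgroup_integral_points ZL NZ.
exists gT, Q, P; split=> //; first exact: (nilpotent_quotient sL LU rhoM QP).
move=> m /andP[m_gt0 mn]; rewrite /zeta.
have -> : of_cindex G (lattices R G) m =
    (fun H : {group gT} => preimage_group L rho H) @` [set` cindex_groups Q P m].
  apply/seteqP; split=> [D [lD cD]|_ [H + <-]].
    have [ND DL] : N `<=` D /\ D `<=` L by apply: bnd; rewrite ?cD.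
    have [sD _ _] := lD.
    have [H HQ DH] := preimage_group_surj sL rhoM rhoN QP sD DL ND.
    exists H => //=; rewrite inE HQ /= -(cindex_preimage sL rhoM QP PQ HQ) -ZP -DH.
    exact/eqP.
  rewrite /= inE => /andP[HQ /eqP cH]; split.
    split; first exact: (is_subgroup_preimage sL rhoM).
      by move=> x [/LG].
    by rewrite ZP; apply: (commensurable_preimage sL rhoM QP).
  by rewrite ZP (cindex_preimage sL rhoM QP PQ HQ).
split; first by apply: finite_image; apply: finite_finset.
apply: card_fset_set_image => H K; rewrite !inE => /andP[HQ _] /andP[KQ _] e.
by apply: val_inj; apply: (preimage_group_inj QP) e; rewrite inE.
Qed.

Lemma finite_lattices (n : nat) : (0 < n)%N -> finite_set (of_cindex G (lattices R G) n).
Proof.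
move=> n_gt0; have [gT [Q [P [_ _ zQ]]]] := lattices_quotient n.
by have [] := zQ n; rewrite ?n_gt0 ?leqnn.
Qed.

Lemma zeta_lattices1 : zeta G (lattices R G) 1 = 1%N.
Proof.
have [gT [Q [P [_ PQ /(_ 1%N isT)[_ ->]]]]] := lattices_quotient 1.
exact: card_cindex_groups1.
Qed.

Lemma zeta_lattices_coprime (m k : nat) : (0 < m)%N -> (0 < k)%N -> coprime m k ->
  zeta G (lattices R G) (m * k) =
  (zeta G (lattices R G) m * zeta G (lattices R G) k)%N.
Proof.
move=> m0 k0 mk; have [gT [Q [P [nilQ PQ zQ]]]] := lattices_quotient (m * k).
have zE j : (0 < j <= m * k)%N -> zeta G (lattices R G) j = #|cindex_groups Q P j|.
  by move/zQ => [].
rewrite (zE (m * k)%N) ?muln_gt0 ?m0 ?k0 ?leqnn //.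
rewrite (zE m) ?m0 ?leq_pmulr // (zE k) ?k0 ?leq_pmull //.
exact: card_cindex_groups_coprime.
Qed.

(** By symmetry of [cindex], the condition defining [plattices] bears on [n] alone: [n] must be a
    power of [p]. *)
Lemma of_cindex_plattices (p n : nat) : prime p -> (0 < n)%N ->
  of_cindex G (plattices R G p) n =
  if p.-nat n then of_cindex G (lattices R G) n else set0.
Proof.
move=> pp n_gt0; case: ifPn => pn; apply/seteqP; split=> D //.
- by case=> -[].
- move=> [lD cD]; split=> //; split=> //; exists (logn p n).
  by rewrite cindexC cD -p_part part_pnat_id.
case=> -[lD [k]]; rewrite cindexC => ck; rewrite ck => e.
by move: pn; rewrite -e pnatX pnat_id.
Qed.

End IntegralPoints.

Theorem proposition1p2 (R : realType) (d : nat) (G : unipotent_Zgroup d) :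
  [/\ zeta_defined G (lattices R G),
      forall p : nat, prime p -> zeta_defined G (plattices R G p) &
      is_prime_product (zeta G (lattices R G))
                       (fun p : nat => zeta G (plattices R G p))].
Proof.
split=> [n n_gt0|p pp n n_gt0|]; first exact: finite_lattices.
  by rewrite of_cindex_plattices //; case: ifP => // _; apply: finite_lattices.
apply: is_prime_product_multiplicative => [|m k|p n pp n_gt0].
- exact: zeta_lattices1.
- exact: zeta_lattices_coprime.
rewrite /zeta of_cindex_plattices //; case: ifP => // _.
by rewrite fset_set0 cardfs0.
Qed.
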